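(* Let $G$ be an abelian group of infinite torsion-free rank with torsion subgroup $T$. If $G$ is semi-generalized co-Bassian, then $G/T$ is divisible and $T$ is isomorphic to $D\oplus E$ for some divisible group $D$ and some elementary group $E$.
   Context: All groups are abelian, written additively. A subgroup $H$ of a group $A$ is essential in $A$ if $H\cap S\neq\{0\}$ for every non-zero subgroup $S$ of $A$ (so $\{0\}$ is essential in $\{0\}$). A group $G$ is semi-generalized co-Bassian if, for every subgroup $H\leq G$ and every injective homomorphism $\varphi:G\to G/H$, the image $\varphi(G)$ is an essential subgroup of some direct summand of $G/H$. The torsion-free rank of $G$ is the rank of $G/T$. A group is elementary if it is a torsion group all of whose $p$-components are annihilated by $p$, i.e. it is a direct sum of cyclic groups of prime order (possibly for different primes). *)

(* Defs.v *)
From HB Require Import structures.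
From mathcomp Require Import all_boot all_order all_algebra.
From mathcomp Require Import ring_quotient.
From mathcomp Require Import boolp classical_sets cardinality.

Set Implicit Arguments.
Unset Strict Implicit.
Unset Printing Implicit Defensive.

Import GRing.Theory.
Local Open Scope ring_scope.

(* Subgroups of an abelian group A are the bundled closed predicates
   [zmodClosed A].  Their values are booleans, but by [boolp.asbool] every
   Prop-valued subgroup is of this form.  The quotient A / H is
   [Quotient.quot H], from ring_quotient. *)

Definition torsion (A : zmodType) : {pred A} :=
  fun x => `[< exists2 n : nat, (0 < n)%N & x *+ n = 0 >].

Fact torsion_closed (A : zmodType) : zmod_closed (@torsion A).
Proof.
split=> [|x y /asboolP[m m0 xm] /asboolP[n n0 yn]]; apply/asboolP.
  by exists 1%N; rewrite // mul0rn.
exists (m * n)%N; first by rewrite muln_gt0 m0.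
by rewrite mulrnBl mulrnA xm mul0rn mulnC mulrnA yn mul0rn subrr.
Qed.

HB.instance Definition _ (A : zmodType) :=
  GRing.isZmodClosed.Build A (@torsion A) (torsion_closed A).

Definition torsion_subgroup (A : zmodType) : zmodClosed A := @torsion A.

Definition hom_image (A B : zmodType) (f : {additive A -> B}) : {pred B} :=
  fun y => `[< exists x, f x = y >].

Fact image_closed (A B : zmodType) (f : {additive A -> B}) :
  zmod_closed (hom_image f).
Proof.
split=> [|_ _ /asboolP[x <-] /asboolP[y <-]]; apply/asboolP.
  by exists 0; rewrite raddf0.
by exists (x - y); rewrite raddfB.
Qed.

HB.instance Definition _ (A B : zmodType) (f : {additive A -> B}) :=
  GRing.isZmodClosed.Build B (hom_image f) (image_closed f).

Definition image_subgroup (A B : zmodType) (f : {additive A -> B}) :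
  zmodClosed B := hom_image f.

Definition group_of (A : zmodType) (H : zmodClosed A) := {x : A | x \in H}.

HB.instance Definition _ (A : zmodType) (H : zmodClosed A) :=
  SubChoice.on (group_of H).
HB.instance Definition _ (A : zmodType) (H : zmodClosed A) :=
  [SubChoice_isSubZmodule of group_of H by <:].

Definition isomorphic (A B : zmodType) : Prop :=
  exists f : {additive A -> B}, bijective f.

(* H is an essential subgroup of the group K, where K <= A. *)
Definition essential_in (A : zmodType) (H K : zmodClosed A) : Prop :=
  {subset H <= K} /\
  forall S : zmodClosed A, {subset S <= K} ->
    (exists2 x, x \in S & x != 0) ->
    exists x, [/\ x \in H, x \in S & x != 0].

Definition direct_summand (A : zmodType) (K : zmodClosed A) : Prop :=
  exists L : zmodClosed A,
    (forall x, x \in K -> x \in L -> x = 0) /\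
    (forall a, exists k l, [/\ k \in K, l \in L & a = k + l]).

Definition semi_generalized_co_Bassian (G : zmodType) : Prop :=
  forall (H : zmodClosed G) (phi : {additive G -> Quotient.quot H}),
    injective phi ->
    exists2 K : zmodClosed (Quotient.quot H),
      direct_summand K & essential_in (image_subgroup phi) K.

Definition divisible (A : zmodType) : Prop :=
  forall (n : nat) (x : A), (0 < n)%N -> exists y : A, y *+ n = x.

Definition p_component (A : zmodType) (p : nat) (x : A) : Prop :=
  exists k : nat, x *+ (p ^ k) = 0.

Definition elementary (A : zmodType) : Prop :=
  (forall x : A, x \in torsion_subgroup A) /\
  (forall p : nat, prime p -> forall x : A, p_component p x -> x *+ p = 0).

Definition independent (A : zmodType) (X : set A) : Prop :=
  forall (s : seq A) (c : A -> int),
    uniq s -> (forall x, x \in s -> X x) ->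
    \sum_(x <- s) x *~ c x = 0 -> forall x, x \in s -> c x = 0.

Definition maximal_independent (A : zmodType) (X : set A) : Prop :=
  independent X /\
  forall Y : set A, independent Y -> (X `<=` Y)%classic -> Y = X.

(* The quotient of G by its torsion subgroup is torsion-free, so its rank is the
   common cardinality of its maximal Z-linearly independent subsets. *)
Definition infinite_torsion_free_rank (G : zmodType) : Prop :=
  exists2 X : set (Quotient.quot (torsion_subgroup G)),
    maximal_independent X & infinite_set X.

(* Main.v *)
From HB Require Import structures.
Require Import Defs.
From mathcomp Require Import all_boot all_algebra ring_quotient.
From mathcomp Require Import boolp classical_sets functions cardinality.

(* The heart of the matter is that G = G[p] + pG for every prime p.  Given x in
   G, let F <= pG be generated by px and by p times an infinite independent
   sequence.  Being countable, F embeds by some psi in a countable divisible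
   group B; having infinite rank, F maps onto B by some sigma; both extend to G.
   With H the kernel of sigma on F, F/H is a copy of B inside G/H, and
   phi = q + psi - sigma, with q the projection, is an embedding of G in G/H
   that agrees with psi on F.  If phi(G) is essential in a summand K of G/H,
   then phi(px) lies in K and in the divisible group F/H, so it is p^2 k with k
   in K; now phi(x) - pk lies in K[p] = phi(G[p]), and reading this modulo F
   gives x in G[p] + pG.
   Hence G/T is divisible, and T = T[p] + pT for all p.  The intersection D of
   all the pT is then divisible, so it has a complement E in T; a p-element x of
   E has px in D, so px = 0. *)

Set Implicit Arguments.
Unset Strict Implicit.
Unset Printing Implicit Defensive.

Import GRing.Theory.
Local Open Scope ring_scope.
Local Open Scope quotient_scope.

(** * Subgroups and homomorphisms from predicates; orders modulo a subgroup *)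

Lemma ex_zmodClosed (A : zmodType) (S : A -> Prop) :
  S 0 -> (forall x y, S x -> S y -> S (x - y)) ->
  exists L : zmodClosed A, forall x, x \in L <-> S x.
Proof.
move=> S0 SB.
pose L : pred A := fun x => `[< S x >].
have Lc : zmod_closed L.
  by split=> [|x y /asboolP Sx /asboolP Sy]; apply/asboolP => //; apply: SB.
pose LC : zmodClosed A := HB.pack L (GRing.isZmodClosed.Build A L Lc).
by exists LC => x; split=> [/asboolP|Sx] //; apply/asboolP.
Qed.

(** A total relation that is closed under differences and relates 0 only to 0 is the graph of a
    homomorphism: two values at one point differ by a value at 0. *)
Lemma ex_additive (A B : zmodType) (R : A -> B -> Prop) :
  (forall a, exists b, R a b) -> (forall b, R 0 b -> b = 0) ->
  (forall a b a' b', R a b -> R a' b' -> R (a - a') (b - b')) ->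
  exists f : {additive A -> B}, forall a, R a (f a).
Proof.
move=> /choice[f Rf] R0 RB.
have fB : zmod_morphism f.
  move=> x y; apply/eqP; rewrite -subr_eq0; apply/eqP/R0.
  by rewrite -(subrr (x - y)); apply: (RB _ _ _ _ (Rf _)); apply: RB.
pose fA : {additive A -> B} := HB.pack f (GRing.isZmodMorphism.Build A B f fB).
by exists fA.
Qed.

(** The integers carrying [x] into [S] form a non-zero ideal; [m], its positive generator, is the
    order of [x] modulo [S]. *)
Lemma mulrn_in_min (A : zmodType) (S : zmodClosed A) (x : A) (n : nat) :
  (0 < n)%N -> x *+ n \in S ->
  exists m, [/\ (0 < m)%N, x *+ m \in S
    & forall i : int, x *~ i \in S -> (m%:Z %| i)%Z].
Proof.
move=> n0 nS; have ex : exists m, (0 < m)%N && (x *+ m \in S).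
  by exists n; rewrite n0.
case: (ex_minnP ex) => m /andP[m0 mS] mmin; exists m; split=> // i iS.
have m0' : m%:Z != 0 by rewrite -lt0n.
have rS : x *~ (i %% m%:Z)%Z \in S.
  have -> : (i %% m%:Z)%Z = i - (i %/ m%:Z)%Z * m%:Z.
    by rewrite {2}(divz_eq i m%:Z) addrAC subrr add0r.
  rewrite mulrzBr rpredB // mulrC mulrzA rpredMz //.
have := modz_ge0 i m0'; case r: (i %% m%:Z)%Z rS => [[|k]|//] kS _.
  exact/dvdz_mod0P.
have := @ltz_pmod i m%:Z m0; rewrite r ltz_nat ltnNge => /negP[].
exact: mmin.
Qed.

(** * Divisible groups: complements and extension of homomorphisms *)

(** [L] is maximal among the subgroups containing [R] and meeting [D] trivially. An [a] outside
    [D + L] would allow a larger one: adjoin [a] itself if no positive multiple of it lies in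
    [D + L], and otherwise a translate of [a] by an element of [D]. *)
Lemma divisible_complement (A : zmodType) (D R : zmodClosed A) :
  (forall (n : nat) x, (0 < n)%N -> x \in D ->
    exists2 y, y \in D & y *+ n = x) ->
  (forall x, x \in D -> x \in R -> x = 0) ->
  exists L : zmodClosed A,
    [/\ {subset R <= L}, forall x, x \in D -> x \in L -> x = 0
      & forall a, exists d l, [/\ d \in D, l \in L & a = d + l]].
Proof.
move=> Ddiv DR.
pose good (S : set A) := [/\ (forall x y, S x -> S y -> S (x - y)),
  (forall x, x \in R -> S x) & forall x, x \in D -> S x -> x = 0].
have [|S [S0 Smax]] := @Zorn_bigcup A (fun S => S = set0 \/ good S).
  move=> F Fgood Ftot.
  have [[S1 FS1 gS1]|none] := pselect (exists2 S, F S & good S); last first.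
    left; rewrite -subset0 => x [S FS Sx].
    have [S00|gS] := Fgood _ FS; first by rewrite S00 in Sx.
    by case: none; exists S.
  right; split=> [x y [S FS Sx] [S' FS' S'y]|x xR|x xD [S FS Sx]].
  - have [SS'|S'S] := Ftot _ _ FS FS'.
      exists S' => //; have [S00|[h _ _]] := Fgood _ FS'.
        by rewrite S00 in S'y.
      exact: h (SS' _ Sx) _.
    exists S => //; have [S00|[h _ _]] := Fgood _ FS.
      by rewrite S00 in Sx.
    exact: h Sx (S'S _ S'y).
  - by exists S1 => //; case: gS1 => _ h _; apply: h.
  - have [S00|[_ _ h]] := Fgood _ FS; last exact: h.
    by rewrite S00 in Sx.
have gR : good (fun x : A => is_true (x \in R)).
  split=> [x y|x|x] /=; [exact: rpredB|by []|exact: DR].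
have gS : good S.
  case: S0 => // S0; exfalso; apply: (Smax (fun x : A => is_true (x \in R)));
    last by right.
  rewrite S0; split; first by move=> ?.
  by move=> /(_ 0 (rpred0 R)).
have [SB SR SD] := gS.
have [L LP] := ex_zmodClosed (SR 0 (rpred0 R)) SB.
exists L; split=> [x xR|x xD /LP|]; [by apply/LP/SR|exact: SD|].
have Lmax x : (forall l (i : int),
    l \in L -> l + x *~ i \in D -> l + x *~ i = 0) -> x \in L.
  move=> xD; apply/LP; apply: contrapT => nSx.
  pose S' : set A := fun z =>
    exists2 l, l \in L & exists i : int, z = l + x *~ i.
  apply: (Smax S'); last first.
    right; split=> [_ _ [l lL [i ->]] [l' l'L [i' ->]]|z zR|z zD [l lL [i zE]]].
    - exists (l - l'); first exact: rpredB.
      by exists (i - i'); rewrite mulrzBr opprD addrACA.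
    - by exists z; [apply/LP/SR|exists 0; rewrite mulr0z addr0].
    - by rewrite zE in zD *; apply: xD.
  split=> [z Sz|sub].
    by exists z; [apply/LP|exists 0; rewrite mulr0z addr0].
  by apply/nSx/sub; exists 0; [exact: rpred0|exists 1; rewrite add0r mulr1z].
have [DL DLP] : exists DL : zmodClosed A,
    forall x, x \in DL <-> exists d l, [/\ d \in D, l \in L & x = d + l].
  apply: ex_zmodClosed => [|_ _ [d [l [dD lL ->]]] [d' [l' [d'D l'L ->]]]].
    by exists 0, 0; rewrite !rpred0 addr0.
  by exists (d - d'), (l - l'); rewrite !rpredB // opprD addrACA.
move=> a; apply/DLP; apply: contrapT => naDL.
have DDL d : d \in D -> d \in DL.
  by move=> dD; apply/DLP; exists d, 0; rewrite dD rpred0 addr0.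
have LDL l : l \in L -> l \in DL.
  by move=> lL; apply/DLP; exists 0, l; rewrite lL rpred0 add0r.
have [[n n0 nDL]|none] := pselect (exists2 n, (0 < n)%N & a *+ n \in DL).
  have [m [m0 mDL mdvd]] := mulrn_in_min n0 nDL.
  have /DLP[d [l [dD lL aml]]] := mDL.
  (* The translate [a - d'] still has order [m] modulo [D + L], but now its [m]-th multiple lies in
     [L]. *)
  have [d' d'D dd'] := Ddiv m d m0 dD.
  apply: naDL; rewrite -(subrK d' a) rpredD ?(DDL d') //.
  apply/LDL/Lmax => l' i l'L iD.
  have iDL : a *~ i \in DL.
    have -> : a *~ i = l' + (a - d') *~ i - l' + d' *~ i.
      by rewrite [l' + _]addrC addrK mulrzBl subrK.
    apply: rpredD; last by apply/rpredMz/DDL.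
    by apply: rpredB; [exact: DDL|exact: LDL].
  have /dvdzP[q qi] := mdvd _ iDL.
  have : (a - d') *~ i \in L.
    rewrite qi mulrC mulrzA rpredMz // -pmulrn mulrnBl dd' aml.
    by rewrite addrAC subrr add0r.
  by move=> iL; apply/SD => //; apply/LP; rewrite rpredD.
apply/naDL/LDL/Lmax => l i lL iD.
have iDL : a *~ i \in DL.
  rewrite -[_ *~ i](addrK l); apply: rpredB; last exact: LDL.
  by rewrite addrC; apply: DDL.
case: i iD iDL => [[|i]|i] iD iDL.
- by rewrite mulr0z addr0 in iD *; apply: SD => //; apply/LP.
- by case: none; exists i.+1.
- by case: none; exists i.+1 => //; rewrite -rpredN.
Qed.

(** In [N * B] the divisible subgroup [0 * B] meets the set of pairs [(pi m, f m)] trivially, by the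
    kernel condition. A complement of [0 * B] containing these pairs is the graph of [g]. *)
Lemma divisible_extend (M N B : zmodType)
    (pi : {additive M -> N}) (f : {additive M -> B}) :
  divisible B -> (forall m, pi m = 0 -> f m = 0) ->
  exists g : {additive N -> B}, forall m, g (pi m) = f m.
Proof.
move=> Bdiv kerf.
have [D DP] : exists D : zmodClosed (N * B)%type,
    forall u, u \in D <-> u.1 = 0.
  by apply: ex_zmodClosed => //= x y -> ->; rewrite subr0.
have [R RP] : exists R : zmodClosed (N * B)%type,
    forall u, u \in R <-> exists m, u = (pi m, f m).
  apply: ex_zmodClosed => [|_ _ [m ->] [m' ->]].
    by exists 0; rewrite !raddf0.
  by exists (m - m'); rewrite !raddfB.
have [n [x y] n0 /DP /= ->|u /DP u0 /RP[m um]|L [RL DL DLP]] :=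
  @divisible_complement _ D R.
- have [z <-] := Bdiv n y n0; exists (0, z); first exact/DP.
  by rewrite pairMnE /= mul0rn.
- by rewrite um /= in u0 *; rewrite u0 (kerf _ u0).
have [|b b0|a b a' b' abL a'bL|g gL] :=
  @ex_additive N B (fun a b => (a, b) \in L).
- move=> a; have [[d1 d2] [[l1 l2] [/DP /= -> lL [-> _]]]] := DLP (a, 0).
  by exists l2; rewrite add0r.
- by have [] : (0, b) = 0 :> N * B by apply: DL => //; apply/DP.
- by rewrite (_ : (_, _) = (a, b) - (a', b')) // rpredB.
exists g => m; apply/eqP; rewrite -subr_eq0; apply/eqP.
have [] // : (0, g (pi m) - f m) = 0 :> N * B.
apply: DL; first exact/DP.
rewrite (_ : (_, _) = (pi m, g (pi m)) - (pi m, f m)).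
  by rewrite rpredB // RL //; apply/RP; exists m.
by rewrite -[RHS]/(_, _) /= subrr.
Qed.

(** * The embedding into a quotient; integer combinations of a sequence *)

(** The map [j] inverts the isomorphism of [F/H] with [B] induced by [sigma]. Modulo [F/H], [phi] is
    the projection, so its kernel lies in [F]; there [phi] is [j] after [psi], and both are
    injective. *)
Lemma twisted_embedding (G B : zmodType) (F : zmodClosed G)
    (sigma psi : {additive G -> B}) :
  (forall b, exists2 f, f \in F & sigma f = b) ->
  {in F, forall f, psi f = 0 -> f = 0} ->
  exists (H : zmodClosed G) (phi : {additive G -> Quotient.quot H})
         (j : {additive B -> Quotient.quot H}),
    [/\ {subset H <= F}, injective phi, {in F, forall f, phi f = j (psi f)}
      & forall g, exists2 f, f \in F & phi g = \pi_(Quotient.quot H) (g + f)].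
Proof.
move=> sigF psiF.
have [H HP] : exists H : zmodClosed G,
    forall g, g \in H <-> g \in F /\ sigma g = 0.
  apply: ex_zmodClosed => [|x y [xF x0] [yF y0]].
    by rewrite rpred0 raddf0.
  by rewrite rpredB // raddfB x0 y0 subrr.
have pi0 g : g \in H <-> \pi_(Quotient.quot H) g = 0.
  rewrite -[g]subr0 Quotient.idealrBE subr0 raddf0.
  by split=> /eqP.
have [|b|b q b' q'|j jP] := @ex_additive B (Quotient.quot H) (fun b q =>
  exists2 f, f \in F & sigma f = b /\ q = \pi_(Quotient.quot H) f).
- by move=> b; have [f fF fb] := sigF b; exists (\pi_(Quotient.quot H) f), f.
- by case=> f fF [f0 ->]; apply/pi0/HP.
- move=> [f fF [<- ->]] [f' f'F [<- ->]]; exists (f - f'); first exact: rpredB.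
  by rewrite !raddfB.
have jsig f : f \in F -> j (sigma f) = \pi_(Quotient.quot H) f.
  move=> fF; have [f' f'F [ff' ->]] := jP (sigma f).
  apply/eqP; rewrite -subr_eq0 -raddfB; apply/eqP/pi0/HP.
  by rewrite rpredB // raddfB ff' subrr.
have jinj b : j b = 0 -> b = 0.
  by have [f fF [<- ->]] := jP b => /pi0 /HP[].
have phiB : zmod_morphism
    (fun g => \pi_(Quotient.quot H) g + j (psi g - sigma g)).
  move=> x y; rewrite !raddfB [in RHS]opprD [RHS]addrACA; congr (_ + _).
  by rewrite !opprD !opprK addrACA.
pose phi : {additive G -> Quotient.quot H} :=
  HB.pack (fun g => \pi_(Quotient.quot H) g + j (psi g - sigma g))
   (GRing.isZmodMorphism.Build _ _ _ phiB).
have phiF f : f \in F -> phi f = j (psi f).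
  by move=> fF; rewrite /= raddfB jsig // addrC subrK.
have phiq g : exists2 f, f \in F & phi g = \pi_(Quotient.quot H) (g + f).
  have [f fF fE] := sigF (psi g - sigma g); exists f => //.
  by rewrite /= -fE jsig // raddfD.
exists H, phi, j; split=> //; first by move=> x /HP[].
apply: raddf_inj => g g0; have [f fF gf] := phiq g.
have gF : g \in F.
  rewrite -(addrK f g) rpredB //; have /HP[] // : g + f \in H.
  by apply/pi0; rewrite -gf.
by apply: psiF => //; apply: jinj; rewrite -phiF.
Qed.

(* {poly int} serves as the free abelian group on the monomials 'X^n. *)
Section Combination.
Variables (A : zmodType) (y : nat -> A).

Definition combination (P : {poly int}) : A := \sum_(i < size P) y i *~ P`_i.

Lemma combinationE n (P : {poly int}) : (size P <= n)%N ->
  combination P = \sum_(i < n) y i *~ P`_i.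
Proof.
move=> sPn; rewrite /combination (big_ord_widen n (fun i => y i *~ P`_i)) //.
rewrite [LHS]big_mkcond; apply: eq_bigr => i _; case: ltnP => // sPi.
by rewrite nth_default.
Qed.

Fact combination_is_zmod_morphism : zmod_morphism combination.
Proof.
move=> P Q; pose n := maxn (size P) (size Q).
rewrite !(@combinationE n) ?leq_maxl ?leq_maxr //; last first.
  by rewrite (leq_trans (size_polyD _ _)) // size_polyN.
by rewrite -sumrB; apply: eq_bigr => i _; rewrite coefB mulrzBr.
Qed.

HB.instance Definition _ :=
  GRing.isZmodMorphism.Build {poly int} A combination
    combination_is_zmod_morphism.

Lemma combinationXn n : combination 'X^n = y n.
Proof.
rewrite /combination size_polyXn big_ord_recr big1 /= => [|i _].
  by rewrite coefXn eqxx add0r.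
by rewrite coefXn ltn_eqF // mulr0z.
Qed.

End Combination.

Lemma combinationXM (A : zmodType) (y : nat -> A) P :
  combination y (P * 'X) = combination (y \o succn) P.
Proof.
rewrite (@combinationE _ _ (size P).+1) ?size_polyMX_leq //; last first.
  by rewrite (leq_trans (size_polyMleq _ _)) // size_polyX addn2.
rewrite big_ord_recl coefMX add0r; apply: eq_bigr => i _.
by rewrite coefMX.
Qed.

Lemma combinationMn (A : zmodType) (y : nat -> A) p P :
  combination (fun n => y n *+ p) P = combination y P *+ p.
Proof.
by rewrite -sumrMnl; apply: eq_bigr => i _; rewrite !pmulrn mulrzAC.
Qed.

(** * The decomposition of [G] as [G[p] + pG] *)

(** The order of [x] modulo [S] divides both [m] and [n]. *)
Lemma mulrn_coprime_in (A : zmodType) (S : zmodClosed A) (x : A) (m n : nat) :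
  (0 < m)%N -> coprime m n -> x *+ m \in S -> x *+ n \in S -> x \in S.
Proof.
move=> m0 cop mS nS; have [k [_ kS kdvd]] := mulrn_in_min m0 mS.
have := kdvd n%:Z; rewrite -pmulrn => /(_ nS) kn.
have := kdvd m%:Z; rewrite -pmulrn => /(_ mS) km.
have : (k %| gcdn m n)%N by rewrite dvdn_gcd; apply/andP.
by rewrite (eqP cop) dvdn1 => /eqP k1; rewrite k1 in kS.
Qed.

(** If [z] is non-zero, [H] meets the subgroup generated by [z]. The order of [z] modulo [H] divides
    [p], and it is not [p], since then only the zero multiple of [z] would lie in [H]. *)
Lemma essential_socle (A : zmodType) (H K : zmodClosed A) (p : nat) (z : A) :
  essential_in H K -> prime p -> z \in K -> z *+ p = 0 -> z \in H.
Proof.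
move=> [_ ess] pp zK zp; have p0 := prime_gt0 pp.
have [->|z0] := eqVneq z 0; first exact: rpred0.
have [S SP] : exists S : zmodClosed A,
    forall x, x \in S <-> exists i : int, x = z *~ i.
  apply: ex_zmodClosed => [|_ _ [i ->] [j ->]].
    by exists 0; rewrite mulr0z.
  by exists (i - j); rewrite mulrzBr.
have [_ /SP[i ->]||w [wH /SP[i wi] w0]] := ess S.
- exact: rpredMz.
- by exists z => //; apply/SP; exists 1; rewrite mulr1z.
have zpH : z *+ p \in H by rewrite zp rpred0.
have [k [_ kH kdvd]] := mulrn_in_min p0 zpH.
have kp : (k %| p)%N by have := kdvd p%:Z; rewrite -pmulrn => /(_ zpH).
have /orP[/eqP k1|/eqP {}kp] := (primeP pp).2 _ kp.
  by rewrite k1 in kH.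
have /dvdzP[q iq] : (k%:Z %| i)%Z by apply: kdvd; rewrite -wi.
by move: w0; rewrite wi iq kp mulrC mulrzA -pmulrn zp mul0rz eqxx.
Qed.

Lemma socle_decomposition (G B : zmodType) (F : zmodClosed G)
    (sigma psi : {additive G -> B}) (p : nat) (x : G) :
  semi_generalized_co_Bassian G -> divisible B -> prime p ->
  (forall b, exists2 f, f \in F & sigma f = b) ->
  {in F, forall f, psi f = 0 -> f = 0} ->
  {in F, forall f, exists g, f = g *+ p} -> x *+ p \in F ->
  exists s g, s *+ p = 0 /\ x = s + g *+ p.
Proof.
move=> Gbass Bdiv pp sigF psiF Fp xF; have p0 := prime_gt0 pp.
have [H [phi [j [HF phi_inj phiF phiq]]]] := twisted_embedding sigF psiF.
have [K [L [KL KLP]] ess] := Gbass H phi phi_inj.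
have phiK g : phi g \in K by apply: ess.1; apply/asboolP; exists g.
(* Two factors [p]: one makes [phi x - k *+ p] a [p]-torsion element, the other survives in [k *+ p]
   and yields the term in [pG]. *)
have [b bE] := Bdiv (p * p)%N (psi (x *+ p)) (ltac:(by rewrite muln_gt0 p0)).
have [k [l [kK lL kl]]] := KLP (j b).
(* Both sides lie in [K], and their difference is [l *+ (p * p)], which lies in [L]. *)
have phik : phi x *+ p = k *+ p *+ p.
  apply/eqP; rewrite -subr_eq0; apply/eqP/KL; first by rewrite rpredB ?rpredMn.
  rewrite -raddfMn phiF // -bE raddfMn kl -mulrnA mulrnDl addrAC subrr add0r.
  exact: rpredMn.
have /asboolP[s sE] : phi x - k *+ p \in image_subgroup phi.
  apply: essential_socle ess pp _ _; first by rewrite rpredB ?rpredMn.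
  by rewrite mulrnBl phik subrr.
have [g gk] : exists g, k = \pi_(Quotient.quot H) g.
  by exists (repr k); rewrite reprK.
have [f fF fE] := phiq (x - s).
(* Both [x - s + f] and [g *+ p] project to [phi (x - s) = k *+ p], so they differ by an element of
   [H]. *)
have : (x - s + f) - g *+ p \in F.
  apply: HF; rewrite Quotient.idealrBE -fE raddfB sE opprB addrC subrK.
  by rewrite gk raddfMn.
move=> /Fp[g1 g1E]; have [g2 g2E] := Fp _ fF.
exists s, (g1 + g - g2); split.
  apply: phi_inj; rewrite raddfMn raddf0 sE mulrnBl phik subrr //.
by rewrite mulrnBl mulrnDl -g1E -g2E subrK addrK addrC subrK.
Qed.

Lemma prime_divisible (A : zmodType) :
  (forall p (x : A), prime p -> exists y, y *+ p = x) -> divisible A.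
Proof.
move=> Adiv n; elim/ltn_ind: n => n IH x n0.
have [n1|n1] := leqP n 1.
  by exists x; rewrite (_ : n = 1%N) //; apply/eqP; rewrite eqn_leq n1.
have [p pn] := (pdiv n, pdiv_prime n1).
have [y yx] := Adiv _ x pn.
have [z zy] := IH (n %/ pdiv n)%N (ltn_Pdiv (prime_gt1 pn) n0) y
  (ltac:(by rewrite divn_gt0 ?pdiv_gt0 // dvdn_leq ?pdiv_dvd)).
by exists z; rewrite -yx -zy -mulrnA divnK ?pdiv_dvd.
Qed.

Lemma polyrat_divisible : divisible {poly rat}.
Proof.
move=> n P n0; exists (n%:R^-1 *: P).
by rewrite -scaler_nat scalerA mulfV ?scale1r // Num.Theory.pnatr_eq0 -lt0n.
Qed.

Lemma quot_divisible (A : zmodType) (H : zmodClosed A) :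
  divisible A -> divisible (Quotient.quot H).
Proof.
move=> Adiv n q n0; have [y yq] := Adiv n (repr q) n0.
by exists (\pi_(Quotient.quot H) y); rewrite -raddfMn yq /= reprK.
Qed.

Lemma free_socle_decomposition (G : zmodType) (y : nat -> G) :
  semi_generalized_co_Bassian G ->
  (forall P, combination y P = 0 -> P = 0) ->
  forall (p : nat) (x : G), prime p -> exists s g, s *+ p = 0 /\ x = s + g *+ p.
Proof.
move=> Gbass yfree p x pp; have p0 := prime_gt0 pp.
(* Generators of [F]: [x *+ p] at index 0, then the [y m *+ p], shifted by one. *)
pose yx n := (if n is m.+1 then y m else x) *+ p.
pose emb : {additive {poly int} -> {poly rat}} := map_poly intr.
have emb_inj : injective emb by apply: map_inj_poly; [exact: intr_inj|].
(* [R] consists of the relations between the generators, so [F] is the image of [{poly int}] in the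
   countable divisible group [B], the quotient of [{poly rat}] by [R]. *)
have [R RP] : exists R : zmodClosed {poly rat},
    forall u, u \in R <-> exists2 P, combination yx P = 0 & emb P = u.
  apply: ex_zmodClosed => [|_ _ [P P0 <-] [Q Q0 <-]].
    by exists 0; exact: raddf0.
  by exists (P - Q); rewrite raddfB //= P0 Q0 subrr.
pose B := Quotient.quot R; have Bdiv : divisible B.
  exact/quot_divisible/polyrat_divisible.
pose f : {additive {poly int} -> B} := \pi_B \o emb.
have f0 P : f P = 0 <-> combination yx P = 0.
  have -> : (f P = 0) <-> emb P \in R.
    by rewrite -[emb P]subr0 Quotient.idealrBE raddf0; split=> /eqP.
  by rewrite RP; split=> [[Q Q0 /emb_inj <-]|P0] //; exists P.
have [psi psiE] :=
  divisible_extend (pi := combination yx) Bdiv (fun P => (f0 P).2).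
(* The sequence [r] enumerates [B] through codes of representatives, with value 0 at numbers that
   code nothing. As the [y n *+ p] are independent, [sigma] may send them to the [r n]. *)
pose r n : B := \pi_B (odflt 0 (unpickle n)).
have [|sigma sigmaE] := @divisible_extend _ _ _
    (combination (fun n => y n *+ p)) (combination r) Bdiv.
  move=> P /=; rewrite combinationMn -raddfMn => /yfree Pp.
  suff -> : P = 0 by rewrite raddf0.
  apply/polyP => i; apply/eqP; have := congr1 (coefp i) Pp.
  by rewrite /= coefMn coef0 => /eqP; rewrite Num.Theory.mulrn_eq0 gtn_eqF.
apply: (@socle_decomposition G B (image_subgroup (combination yx)) sigma psi)
  => //.
- move=> b; exists (y (pickle (repr b)) *+ p).
    by apply/asboolP; exists 'X^((pickle (repr b)).+1); exact: combinationXn.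
  rewrite -(combinationXn (fun n => y n *+ p)) sigmaE /=.
  by rewrite combinationXn /r pickleK /= reprK.
- by move=> _ /asboolP[P <-]; rewrite psiE => /f0.
- move=> _ /asboolP[P <-]; eexists; exact: combinationMn.
- by apply/asboolP; exists 'X^0; exact: combinationXn.
Qed.

(** * Splitting a torsion group *)

Lemma direct_sum_isomorphic (A : zmodType) (D E : zmodClosed A) :
  (forall x, x \in D -> x \in E -> x = 0) ->
  (forall a, exists d e, [/\ d \in D, e \in E & a = d + e]) ->
  isomorphic A (group_of D * group_of E)%type.
Proof.
move=> DE DEP.
have [|[d e] de|a [d e] a' [d' e'] /= -> ->|f fP] :=
  @ex_additive A (group_of D * group_of E)%type
    (fun a u => a = val u.1 + val u.2).
- move=> a; have [d [e [dD eE ->]]] := DEP a.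
  by exists (Sub d dD, Sub e eE).
- have dE : val d = - val e by apply/eqP; rewrite -addr_eq0 -de.
  have d0 : val d = 0 by apply: DE; [|rewrite dE rpredN]; apply: valP.
  have e0 : val e = 0 by apply/eqP; rewrite -oppr_eq0 -dE d0.
  by congr (_, _); apply: val_inj; rewrite raddf0.
- by rewrite -[RHS]/(val (d - d') + val (e - e')) !raddfB opprD addrACA.
exists f; exists (fun u => val u.1 + val u.2) => [a|[d e]].
  by rewrite -fP.
apply/eqP; rewrite -subr_eq0.
have := fP (val d + val e); case: (f _) => d' e' /= dE.
have dd' : val d' - val d = val e - val e'.
  by rewrite -[val e](addKr (val d)) dE addrA addrK addrC.
have d0 : val d' - val d = 0.
  by apply: DE; [|rewrite dd']; apply: rpredB; apply: valP.
have e0 : val e' - val e = 0 by rewrite -opprB -dd' d0 oppr0.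
by apply/eqP; congr (_, _); apply: val_inj; rewrite raddfB raddf0.
Qed.

Lemma torsion_decomposition (A : zmodType) :
  (forall x : A, x \in torsion_subgroup A) ->
  (forall p (x : A), prime p -> exists s g, s *+ p = 0 /\ x = s + g *+ p) ->
  exists D E : zmodType,
    [/\ divisible D, elementary E & isomorphic A (D * E)%type].
Proof.
move=> tors socle.
have [|pA pAP] := @choice nat (zmodClosed A) (fun p S =>
    forall x, x \in S <-> exists y, x = y *+ p).
  move=> p; apply: ex_zmodClosed => [|_ _ [y ->] [z ->]].
    by exists 0; rewrite mul0rn.
  by exists (y - z); rewrite mulrnBl.
have [D DP] : exists D : zmodClosed A,
    forall x, x \in D <-> forall p, prime p -> x \in pA p.
  apply: ex_zmodClosed => [p|x y xP yP p pp];
    by rewrite ?rpred0 ?rpredB ?xP ?yP.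
(* Writing [x = y *+ p] and [y = s + z *+ p] gives [x = z *+ p *+ p]. Then [z *+ p] lies in [D]: for
   a prime [r] other than [p], both its [p]-th multiple [x] and its [r]-th multiple lie in [rA]. *)
have pDiv p (x : A) : prime p -> x \in D -> exists2 y, y \in D & y *+ p = x.
  move=> pp xD; have /DP/(_ p pp)/pAP[y xy] := xD.
  have [s [z [sp yE]]] := socle p y pp.
  have zx : z *+ p *+ p = x by rewrite xy yE mulrnDl sp add0r.
  exists (z *+ p) => //; apply/DP => r pr.
  have [->|rp] := eqVneq r p; first by apply/pAP; exists z.
  apply: (@mulrn_coprime_in _ _ _ p r); first exact: prime_gt0.
  - by rewrite prime_coprime // dvdn_prime2 // eq_sym.
  - by rewrite zx; move/DP: xD; apply.
  - by apply/pAP; eexists.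
have Ddiv : divisible (group_of D).
  apply: prime_divisible => p x pp.
  have [y yD yx] := pDiv p (val x) pp (valP x).
  by exists (Sub y yD); apply: val_inj; rewrite raddfMn.
have [Z ZP] : exists Z : zmodClosed A, forall x, x \in Z <-> x = 0.
  by apply: ex_zmodClosed => // x y -> ->; rewrite subr0.
have [n x n0 xD|x _ /ZP|E [_ DE DEP]] := @divisible_complement A D Z => //.
  have [y yx] := Ddiv n (Sub x xD) n0; exists (val y); first exact: valP.
  by rewrite -raddfMn yx.
exists (group_of D), (group_of E).
split=> //; last exact: direct_sum_isomorphic.
split=> [x|p pp x [k xk]].
  have /asboolP[n n0 xn] := tors (val x).
  by apply/asboolP; exists n => //; apply: val_inj; rewrite raddfMn raddf0.
apply: val_inj; rewrite raddf0; apply: DE; last exact: valP.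
(* For [r] other than [p], the multiples of [val x *+ p] by [p ^ k] (which is 0) and by [r] both lie
   in [rA]. *)
rewrite raddfMn; apply/DP => r pr.
have [->|rp] := eqVneq r p; first by apply/pAP; eexists.
apply: (@mulrn_coprime_in _ _ _ (p ^ k) r); first by rewrite expn_gt0 prime_gt0.
- by apply: coprimeXl; rewrite prime_coprime // dvdn_prime2 // eq_sym.
- by rewrite mulrnAC -[val x *+ _]raddfMn xk raddf0 mul0rn rpred0.
- by apply/pAP; eexists.
Qed.

(** * Independent sequences from infinite rank, and the conclusion *)

Lemma independent_combination (A : zmodType) (X : set A) (x : nat -> A) :
  independent X -> injective x -> (forall n, X (x n)) ->
  forall P, combination x P = 0 -> P = 0.
Proof.
move=> Xind xinj xX P P0; apply/polyP => i; rewrite coef0.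
have [iP|] := ltnP i (size P); last exact: nth_default.
pose s := [seq x k | k <- iota 0 (size P)].
have us : uniq s by rewrite map_inj_uniq // iota_uniq.
have idx k : (k < size P)%N -> index (x k) s = k.
  move=> kP; rewrite index_map // -[X in index X](nth_iota 0 0 kP).
  rewrite index_uniq //.
    by rewrite size_iota.
  exact: iota_uniq.
rewrite -(idx i iP).
(* Coefficients in [independent] are indexed by elements; injectivity of [x] lets the position in
   [s] recover the exponent. *)
apply: (Xind s (fun z => P`_(index z s)) us).
- by move=> _ /mapP[k _ ->].
- transitivity (\sum_(0 <= k < size P) x k *~ P`_k); last by rewrite big_mkord.
  rewrite big_map /index_iota subn0; apply: eq_big_seq => k.
  by rewrite mem_iota /= => kP; rewrite idx.
- by apply: map_f; rewrite mem_iota.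
Qed.

Lemma free_sequence (G : zmodType) :
  infinite_torsion_free_rank G ->
  exists y : nat -> G, forall P, combination y P = 0 -> P = 0.
Proof.
move=> [X [Xind _] Xinf].
have [x xinj xX] : exists2 x, injective x & forall n : nat, X (x n).
  have /infiniteP/card_leP[f] := Xinf.
  exists (fun n => val (f (to_setT n))) => [m n /val_inj fmn|n];
    last exact: set_valP.
  by have /(congr1 val) := inj (in_setT _) (in_setT _) fmn.
(* A relation between the lifts projects to one between the independent classes. *)
exists (repr \o x) => P P0; apply: (independent_combination Xind xinj xX).
transitivity (\pi_(Quotient.quot (torsion_subgroup G))
  (combination (repr \o x) P)).
  by rewrite raddf_sum; apply: eq_bigr => i _; rewrite raddfMz /= reprK.
by rewrite P0 raddf0.
Qed.

Theorem proposition2p11 (G : zmodType) :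
  infinite_torsion_free_rank G ->
  semi_generalized_co_Bassian G ->
  divisible (Quotient.quot (torsion_subgroup G)) /\
  exists D E : zmodType,
    [/\ divisible D, elementary E
      & isomorphic (group_of (torsion_subgroup G)) (D * E)%type].
Proof.
move=> /free_sequence[y yfree] Gbass.
have socle := free_socle_decomposition Gbass yfree.
have tors s p : prime p -> s *+ p = 0 -> s \in torsion_subgroup G.
  by move=> pp sp; apply/asboolP; exists p; first exact: prime_gt0.
split.
  apply: prime_divisible => p q pp; have [s [g [sp qE]]] := socle p (repr q) pp.
  exists (\pi_(Quotient.quot (torsion_subgroup G)) g).
  rewrite -raddfMn -[RHS]reprK qE; apply/eqP.
  rewrite eq_sym -Quotient.idealrBE addrK.
  exact: tors sp.
apply: torsion_decomposition => [x|p x pp].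
  have /asboolP[n n0 xn] := valP x.
  by apply/asboolP; exists n => //; apply: val_inj; rewrite raddfMn raddf0.
have [s [g [sp xE]]] := socle p (val x) pp.
have sT := tors s p pp sp.
(* The decomposition in [G] stays inside the torsion subgroup, because [g *+ p] is the difference of
   the torsion elements [val x] and [s]. *)
have gT : g \in torsion_subgroup G.
  have /asboolP[n n0 xn] := valP x; apply/asboolP; exists (p * n * p)%N.
    by rewrite !muln_gt0 n0 prime_gt0.
  have -> : g *+ (p * n * p) = val x *+ n *+ p - s *+ p *+ n.
    by rewrite xE !mulrnDl [s *+ n *+ p]mulrnAC addrAC subrr add0r !mulrnA.
  by rewrite xn sp !mul0rn subrr.
exists (Sub s sT), (Sub g gT); split; apply: val_inj.
  by rewrite raddfMn raddf0.
by rewrite raddfD raddfMn.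
Qed.
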